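(* For every integer $s\ge1$ one has $L_s<1$, where $L_s=T^{n,n-s}_{s,1,L}$ (for $n\ge 4s$) is the label of the left side of the triangle in row $s$ and diagonal $1$ of the grid $T^{n,n-s}$ obtained from the all-ones $n$-grid by $s$ reductions.
   Context: Labeled grids. An $N$-grid is the triangular grid graph with $N$ rows of upright triangles. The upright triangles are $T_{r,d}$ with $1\le d\le r\le N$ ($r$ is the row, counted from the top; $d$ is the diagonal, counted from the left). Each edge of the grid is a side of exactly one upright triangle, and the left, right and base sides of $T_{r,d}$ are denoted $T_{r,d,L},T_{r,d,R},T_{r,d,B}$. The bottom-right vertex of $T_{r,d}$, the bottom-left vertex of $T_{r,d+1}$ and the top vertex of $T_{r+1,d+1}$ coincide (whenever these exist). A labeled $N$-grid assigns a positive real number (resistance) to each edge; the symbol $T_{r,d,X}$, $X\in\{L,R,B\}$, also denotes this label. Reduction. For positive reals put $\Delta(x,y,z)=\frac{xy}{x+y+z}$ and $Y(x,y,z)=\frac{xy+yz+zx}{x}$. The reduction of a labeled $N$-grid ($N\ge2$) is a labeled $(N-1)$-grid obtained by applying $\Delta$–Y transformations to all upright triangles, discarding the three corner tails, making series transformations along the boundary and Y–$\Delta$ transformations in the interior. Explicitly, if $T_{r,d}$ has labels $(l,\rho,b)$ on its (left, right, base) sides, set $Y_{12,r,d}=\Delta(l,\rho,b)$, $Y_{8,r,d}=\Delta(b,l,\rho)$, $Y_{4,r,d}=\Delta(\rho,b,l)$. The reduced grid has, for $1\le d\le r\le N-1$, labels left: $Y_{8,r,1}+Y_{12,r+1,1}$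 if $d=1$, and $Y(Y_{4,r,d-1},Y_{8,r,d},Y_{12,r+1,d})$ if $d\ge2$; right: $Y_{4,r,r}+Y_{12,r+1,r+1}$ if $d=r$, and $Y(Y_{8,r,d+1},Y_{12,r+1,d+1},Y_{4,r,d})$ if $d\le r-1$; base: $Y_{4,N,d}+Y_{8,N,d+1}$ if $r=N-1$, and $Y(Y_{12,r+2,d+1},Y_{4,r+1,d},Y_{8,r+1,d+1})$ if $r\le N-2$. $T^{n}=T^{n,n}$ is the $n$-grid with all labels equal to $1$, and $T^{n,m}$ (for $1\le m\le n$) is the labeled $m$-grid obtained from it by $n-m$ successive reductions. $T^{n,m}_{r,d,X}$ is the label of side $X$ of its triangle in row $r$ and diagonal $d$. As the notation $L_s$ indicates, the value $T^{n,n-s}_{s,1,L}$ is the same for all $n\ge4s$. *)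

(* Defs.v *)
From HB Require Import structures.
From mathcomp Require Import all_boot all_order all_algebra.
From mathcomp Require Import all_reals.
From mathcomp Require Import zify.

Set Implicit Arguments.
Unset Strict Implicit.
Unset Printing Implicit Defensive.

Import Order.TTheory GRing.Theory Num.Theory.
Local Open Scope ring_scope.

Inductive side := SideL | SideR | SideB.

(* [T r d X] is the label of side [X] of the upright triangle in row [r] and
   diagonal [d], both counted from 1.  For an [N]-grid only the values with
   [1 <= d <= r <= N] have a meaning; the others are junk, never read by the
   reduction (lemma [reduction_local]).  Positivity of the labels is the
   predicate [labeled_grid], which the reduction preserves. *)
Definition labeling (R : realType) := nat -> nat -> side -> R.

Definition in_grid (N r d : nat) : bool := (1 <= d <= r)%N && (r <= N)%N.

Definition labeled_grid (R : realType) (N : nat) (T : labeling R) : Prop :=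
  forall (r d : nat) (X : side), in_grid N r d -> 0 < T r d X.

Definition Delta (R : realType) (x y z : R) : R := x * y / (x + y + z).
Definition Wye (R : realType) (x y z : R) : R := (x * y + y * z + z * x) / x.

(* The legs of the Y replacing a triangle, named after the clock position
   (12, 4 or 8) of the vertex they lead to. *)
Definition Y12 (R : realType) (T : labeling R) (r d : nat) : R :=
  Delta (T r d SideL) (T r d SideR) (T r d SideB).
Definition Y8 (R : realType) (T : labeling R) (r d : nat) : R :=
  Delta (T r d SideB) (T r d SideL) (T r d SideR).
Definition Y4 (R : realType) (T : labeling R) (r d : nat) : R :=
  Delta (T r d SideR) (T r d SideB) (T r d SideL).

(* From an [N]-grid to an [N.-1]-grid, for [2 <= N]. *)
Definition reduction (R : realType) (N : nat) (T : labeling R) : labeling R :=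
  fun r d X =>
    match X with
    | SideL =>
        if d == 1%N then Y8 T r 1 + Y12 T r.+1 1
        else Wye (Y4 T r d.-1) (Y8 T r d) (Y12 T r.+1 d)
    | SideR =>
        if d == r then Y4 T r r + Y12 T r.+1 r.+1
        else Wye (Y8 T r d.+1) (Y12 T r.+1 d.+1) (Y4 T r d)
    | SideB =>
        if r == N.-1 then Y4 T N d + Y8 T N d.+1
        else Wye (Y12 T r.+2 d.+1) (Y4 T r.+1 d) (Y8 T r.+1 d.+1)
    end.

Fixpoint reductions (R : realType) (N k : nat) (T : labeling R) : labeling R :=
  if k is k'.+1 then reduction (N - k') (reductions N k' T) else T.

Definition ones_grid (R : realType) : labeling R := fun _ _ _ => 1.

(* T^{n,m}, for [1 <= m <= n]. *)
Definition Tgrid (R : realType) (n m : nat) : labeling R :=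
  reductions n (n - m) (@ones_grid R).

Lemma Delta_gt0 (R : realType) (x y z : R) :
  0 < x -> 0 < y -> 0 < z -> 0 < Delta x y z.
Proof. by move=> x0 y0 z0; rewrite divr_gt0 ?mulr_gt0 ?addr_gt0. Qed.

Lemma Wye_gt0 (R : realType) (x y z : R) :
  0 < x -> 0 < y -> 0 < z -> 0 < Wye x y z.
Proof. by move=> x0 y0 z0; rewrite divr_gt0 ?addr_gt0 ?mulr_gt0. Qed.

Lemma reduction_labeled_grid (R : realType) (N : nat) (T : labeling R) :
  (2 <= N)%N -> labeled_grid N T -> labeled_grid N.-1 (reduction N T).
Proof.
case: N => [|N] //= N1 TP.
have P12 r d : in_grid N.+1 r d -> 0 < Y12 T r d.
  by move=> rd; apply: Delta_gt0; apply: TP.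
have P8 r d : in_grid N.+1 r d -> 0 < Y8 T r d.
  by move=> rd; apply: Delta_gt0; apply: TP.
have P4 r d : in_grid N.+1 r d -> 0 < Y4 T r d.
  by move=> rd; apply: Delta_gt0; apply: TP.
move=> r d X /andP[/andP[d1 dr] rN]; case: X => /=; case: eqP => e;
  try (apply: addr_gt0); try (apply: Wye_gt0);
  (apply: P12 || apply: P8 || apply: P4); rewrite /in_grid; lia.
Qed.

Lemma reduction_local (R : realType) (N : nat) (T T' : labeling R) :
  (2 <= N)%N ->
  (forall r d X, in_grid N r d -> T r d X = T' r d X) ->
  forall r d X, in_grid N.-1 r d -> reduction N T r d X = reduction N T' r d X.
Proof.
case: N => [|N] //= N1 TT.
have E12 r d : in_grid N.+1 r d -> Y12 T r d = Y12 T' r d.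
  by move=> rd; rewrite /Y12 !TT.
have E8 r d : in_grid N.+1 r d -> Y8 T r d = Y8 T' r d.
  by move=> rd; rewrite /Y8 !TT.
have E4 r d : in_grid N.+1 r d -> Y4 T r d = Y4 T' r d.
  by move=> rd; rewrite /Y4 !TT.
by move=> r d X /andP[/andP[d1 dr] rN]; case: X => /=; case: eqP => e;
  rewrite ?E12 ?E8 ?E4 // /in_grid; lia.
Qed.

(* Main.v *)
Require Import Defs.
From mathcomp Require Import all_boot all_order all_algebra.
From mathcomp Require Import all_reals.
From mathcomp Require Import zify.

Set Implicit Arguments.
Unset Strict Implicit.
Unset Printing Implicit Defensive.

Import Order.TTheory GRing.Theory Num.Theory.
Local Open Scope ring_scope.

(** Away from the right side and the base, the grids are invariant under
    translation along the left side. Where consecutive rows agree, a reduction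
    replaces a left boundary label [l] of a triangle with other labels [x], [b]
    by [l * (x + b) / (l + x + b)], which is less than [l]; so the left boundary
    labels decrease strictly from their initial value 1. *)

Lemma labeled_grid_reductions (R : realType) (n k : nat) :
  (k < n)%N -> labeled_grid (n - k) (reductions n k (ones_grid R)).
Proof.
elim: k => [_ r d X _|k IHk kn]; first exact: ltr01.
by rewrite subnS; apply: reduction_labeled_grid; [lia | apply: IHk; lia].
Qed.

(** A reduction reads triangles at most one diagonal to the right and two rows down, so each one
    costs one unit of distance to the right side and two rows above the base. *)
Lemma reductions_translation (R : realType) (n k r d : nat) (X : side) :
  (0 < d)%N -> (d + k <= r)%N -> (r.+1 + k.*2 <= n)%N ->
  reductions n k (ones_grid R) r.+1 d X = reductions n k (ones_grid R) r d X.
Proof.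
elim: k r d X => [//|k IHk] r d X d_gt0 dr rn /=.
rewrite /reduction /Y4 /Y8 /Y12; case: X.
- by case: eqP => d1; rewrite !IHk //; lia.
- have -> : (d == r.+1) = false by lia.
  have -> : (d == r) = false by lia.
  by rewrite !IHk //; lia.
- have -> : (r.+1 == (n - k).-1) = false by lia.
  have -> : (r == (n - k).-1) = false by lia.
  by rewrite !IHk //; lia.
Qed.

Lemma Delta_add_lt (R : realType) (l x b : R) :
  0 < l -> 0 < x -> 0 < b -> Delta b l x + Delta l x b < l.
Proof.
move=> l0 x0 b0; rewrite /Delta.
have -> : b + l + x = l + x + b by rewrite -addrA addrC.
rewrite -mulrDl ltr_pdivrMr ?addr_gt0 // (mulrC b) -mulrDr ltr_pM2l //.
by rewrite -addrA (addrC b) ltrDr.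
Qed.

Lemma reductions_left_lt (R : realType) (n k r : nat) :
  (k < r)%N -> (r.+1 + k.*2 <= n)%N ->
  reductions n k.+1 (ones_grid R) r 1 SideL
    < reductions n k (ones_grid R) r 1 SideL.
Proof.
(* The leg [Y12] from row [r.+1] becomes a leg of the triangle in row [r]. *)
move=> kr rn /=; rewrite /Y8 /Y12 !reductions_translation //.
by apply: Delta_add_lt; apply: (@labeled_grid_reductions R n k);
  rewrite /in_grid; lia.
Qed.

Lemma reductions_left_le1 (R : realType) (n k r : nat) :
  (k <= r)%N -> (r + k.*2 <= n)%N ->
  reductions n k (ones_grid R) r 1 SideL <= 1.
Proof.
elim: k => [//|k IHk] kr rn.
by apply: le_trans (ltW (reductions_left_lt R _ _)) (IHk _ _); lia.
Qed.

Theorem corollary7p2 (R : realType) (s : nat) (hs : (1 <= s)%N)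
    (n : nat) (hn : (4 * s <= n)%N) :
  Tgrid R n (n - s)%N s 1%N SideL < 1.
Proof.
rewrite /Tgrid subKn; last by lia.
case: s hs hn => [//|k] _ hn.
(* Strictness comes from the last of the [k.+1] reductions. *)
by apply: lt_le_trans (reductions_left_lt R _ _) (reductions_left_le1 R _ _);
  lia.
Qed.
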